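(* Let the factors $q(\bm z,T)$ and $q(\bm\theta,\bm\tau,\bm\pi,\bm\beta)$ and the parameters $\bm\xi$ be given, and let $q(\bm u)$ be the probability distribution on $(\{0,1\}^{D_{\max}})^n$ determined by $$\ln q(\bm u)=\mathbb{E}_{q(\bm z,T)\,q(\bm\theta,\bm\tau,\bm\pi,\bm\beta)}\bigl[\ln\bigl(p(\bm x,\bm z,T,\bm\theta,\bm\tau,\bm\pi\mid\bm u)\,h(\bm u\mid\bm\beta,\bm\xi)\,p(\bm\beta)\bigr)\bigr]+\mathrm{const.},$$ where ''const.'' does not depend on $\bm u$. Then $q(\bm u)$ factorizes as $q(\bm u)=\prod_{t=1}^n q(\bm u_t)$, and for each $t$ $$q(\bm u_t)=\prod_{s\in\mathcal{I}_{\max}}\prod_{u\in\{0,1\}}(\varpi'_{t,s,s_u})^{I\{s_u\preceq\mathsf{s}(\bm u_t)\}},\qquad \varpi'_{t,s,s_u}:=\frac{\varrho_{t,s,s_u}}{\sum_{u'\in\{0,1\}}\varrho_{t,s,s_{u'}}},$$ where the positive numbers $\varrho_{t,s,s_u}$ ($s\in\mathcal{I}_{\max}$, $u\in\{0,1\}$) are defined recursively from the deepest level upward by $$\ln\varrho_{t,s,s_u}:=\begin{cases}A_{t,s,u}+\ln\sum_{s_{\mathrm{ch}}\in\mathrm{Ch}(s_u)}\varrho_{t,s_u,s_{\mathrm{ch}}}, & s_u\in\mathcal{I}_{\max},\\ A_{t,s,u}, & s_u\in\mathcal{L}_{\max},\end{cases}$$ $$A_{t,s,u}:=\mathbb{E}_{q(\bm\beta_s)}[\ln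 h(u\mid\bm\beta_s,\xi_{s,t})]+\mathbb{E}_{q(\bm z,T)\,q(\bm\theta,\bm\tau)}\Bigl[I\{s_u\in\mathcal{L}_T\}\sum_{k=1}^K z_{s_u,k}\ln\mathcal{N}(x_t\mid\tilde{\bm x}_t^\top\bm\theta_k,\tau_k^{-1})\Bigr].$$ Here $q(\bm\beta_s)$ and $q(\bm\theta,\bm\tau)$ are marginals of $q(\bm\theta,\bm\tau,\bm\pi,\bm\beta)$.
   Context: **Trees.** $T_{\max}$ is the perfect binary rooted tree of depth $D_{\max}\ge 1$ with root $s_\lambda$; $\mathcal{I}_{\max}$, $\mathcal{L}_{\max}$ are its sets of inner and leaf nodes, $\mathcal{S}_{\max}=\mathcal{I}_{\max}\cup\mathcal{L}_{\max}$. $d_s$ is the depth of $s$ ($d_{s_\lambda}=0$). For $s\in\mathcal{I}_{\max}$, $s_0,s_1$ are its left and right children, $\mathrm{Ch}(s)=\{s_0,s_1\}$. $s'\preceq s$ means $s'$ is an ancestor of $s$ or equals $s$. $\mathcal{T}$ is the set of all regular rooted subtrees $T$ of $T_{\max}$ with root $s_\lambda$ (each node of $T$ has, in $T$, either both children or none); $\mathcal{I}_T,\mathcal{L}_T$ are the inner and leaf nodes of $T$. $I\{\cdot\}$ is the indicator function. **Variables.** $\bm u=\{\bm u_t\}_{t=1}^n$, $\bm u_t=[u_{t,0},\dots,u_{t,D_{\max}-1}]^\top\in\{0,1\}^{D_{\max}}$; $\mathsf{s}(\bm u_t)\in\mathcal{L}_{\max}$ is the leaf reached from the root by taking at depth $d$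 the right branch if $u_{t,d}=1$ and the left if $u_{t,d}=0$. $\bm z=\{\bm z_s\}_{s\in\mathcal{L}_T}$, each $\bm z_s\in\{0,1\}^K$ one-hot; an expression $I\{s\in\mathcal{L}_T\}z_{s,k}$ is $0$ if $s\notin\mathcal{L}_T$. $\bm\pi$ is a probability vector of length $K$. $\bm\theta=\{\bm\theta_k\}_{k=1}^K$, $\bm\theta_k\in\mathbb{R}^{D+1}$; $\bm\tau=\{\tau_k\}_{k=1}^K$, $\tau_k>0$. $\bm\beta=\{\bm\beta_s\}_{s\in\mathcal{I}_{\max}}$, $\bm\beta_s\in\mathbb{R}^2$. The data $\bm x=(x_1,\dots,x_n)^\top\in\mathbb{R}^n$ are fixed, $\tilde{\bm x}_t=[x_{t-1},\dots,x_{t-D},1]^\top$ (with $x_0,\dots,x_{1-D}$ given real numbers), $\tilde{\bm t}=[t,1]^\top$. **Model.** $p(\bm x,\bm z,T,\bm\theta,\bm\tau,\bm\pi\mid\bm u)=p(\bm x\mid\bm u,\bm z,\bm\theta,\bm\tau,T)\,p(\bm z\mid\bm\pi,T)\,p(T)\,p(\bm\pi)\,p(\bm\theta,\bm\tau)$ with - $p(\bm x\mid\bm u,\bm z,\bm\theta,\bm\tau,T)=\prod_{t=1}^n\prod_{s\in\mathcal{L}_T}\prod_{k=1}^K\mathcal{N}(x_t\mid\tilde{\bm x}_t^\top\bm\theta_k,\tau_k^{-1})^{z_{s,k}I\{s\preceq\mathsf{s}(\bm u_t)\}}$ ($\mathcal{N}(\cdot\mid m,v)$: normal density with mean $m$,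 variance $v$); - $p(\bm z\mid\bm\pi,T)=\prod_{s\in\mathcal{L}_T}\prod_{k=1}^K\pi_k^{z_{s,k}}$; - $p(T)=\prod_{s\in\mathcal{I}_T}g_s\prod_{s\in\mathcal{L}_T}(1-g_s)$, $g_s\in[0,1]$, $g_s=0$ for $s\in\mathcal{L}_{\max}$; - $p(\bm\pi)=\mathrm{Dir}(\bm\pi\mid\bm\alpha)$, $\bm\alpha\in\mathbb{R}_{>0}^K$; - $p(\bm\theta,\bm\tau)=\prod_{k=1}^K\mathcal{N}(\bm\theta_k\mid\bm\mu,(\tau_k\bm\Lambda)^{-1})\,\mathrm{Gam}(\tau_k\mid a,b)$ ($\bm\Lambda$ positive definite, shape $a>0$, rate $b>0$); - $p(\bm\beta)=\prod_{s\in\mathcal{I}_{\max}}\mathcal{N}(\bm\beta_s\mid\bm\eta_s,\bm L_s^{-1})$ ($\bm L_s$ positive definite). **Local variational bound.** $\bm\xi=\{\xi_{s,t}\}_{s\in\mathcal{I}_{\max},1\le t\le n}$, $\xi_{s,t}\in\mathbb{R}$; $\sigma$ is the logistic sigmoid; $\lambda(\xi)=\frac{1}{2\xi}(\sigma(\xi)-\frac12)$, extended by continuity to $\lambda(0)=1/8$. For $u\in\{0,1\}$, $$h(u\mid\bm\beta_s,\xi_{s,t})=\sigma(\xi_{s,t})\exp\bigl\{\bm\beta_s^\top\tilde{\bm t}\,u-\tfrac12(\bm\beta_s^\top\tilde{\bm t}+\xi_{s,t})-\lambda(\xi_{s,t})((\bm\beta_s^\top\tilde{\bm t})^2-\xi_{s,t}^2)\bigr\},$$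 $$h(\bm u\mid\bm\beta,\bm\xi)=\prod_{t=1}^n\prod_{s\in\mathcal{I}_{\max}}h(u_{t,d_s}\mid\bm\beta_s,\xi_{s,t})^{I\{s\preceq\mathsf{s}(\bm u_t)\}}.$$ **Variational distribution.** The variational distribution has the form $q(\bm u)\,q(\bm z,T)\,q(\bm\theta,\bm\tau,\bm\pi,\bm\beta)$; the given factors are probability distributions for which the expectations of the terms involving $\bm u$ are finite. Log-factors of the model not involving $\bm u$ are absorbed into ''const.''. *)

(* Defs.v *)
From HB Require Import structures.
From mathcomp Require Import all_boot all_order all_algebra.
From mathcomp Require Import all_classical all_reals all_analysis.
From mathcomp Require Import zify.
Set Implicit Arguments.
Unset Strict Implicit.
Unset Printing Implicit Defensive.
Import Order.TTheory GRing.Theory Num.Theory.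
Import numFieldNormedType.Exports.

Local Open Scope ring_scope.

(* A node of the perfect binary tree of depth Dmax is the sequence of branch
   choices (false = left = 0, true = right = 1) leading to it from the root:
   its depth is its size, and "ancestor of or equal to" is [prefix]. *)
Section Tree.
Variable Dmax : nat.

Definition node := Dmax.-bseq bool.
Definition is_inner (s : node) := (size s < Dmax)%N.
Definition is_leaf (s : node) := size s == Dmax.
Definition inner := {s : node | is_inner s}.
Definition root : node := [bseq].

Lemma child_subproof (s : inner) (b : bool) :
  (size (rcons (val s) b) <= Dmax)%N.
Proof. by rewrite size_rcons; exact: (valP s). Qed.

Definition child (s : inner) (b : bool) : node := Bseq (child_subproof s b).

Definition ancestor (s s' : node) : bool := prefix s s'.

(* The leaf reached from the root by the branch choices v is v itself. *)
Definition leaf_of (v : Dmax.-tuple bool) : node := v.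

Definition regular_subtree (T : {set node}) : bool :=
  [&& root \in T,
      [forall s : inner, forall b, (child s b \in T) ==> (val s \in T)] &
      [forall s : inner, (child s false \in T) == (child s true \in T)]].

Definition subtree := {T : {set node} | regular_subtree T}.

Definition inners (T : subtree) : {set inner} :=
  [set s : inner | (val s \in val T) && [forall b, child s b \in val T]].

Definition leaves (T : subtree) : {set node} :=
  [set s in val T | [forall i in inners T, val i != s]].

End Tree.

Section LatentTree.
Variables Dmax K : nat.

Definition onehot := {z : {ffun 'I_K -> bool} | #|[pred k | z k]| == 1%N}.

(* The values of the pair (z, T), with z indexed by the leaves of T. *)
Definition config :=
  {T : subtree Dmax & {ffun {s : node Dmax | s \in leaves T} -> onehot}}.

(* I{s \in L_T} z_{s,k} *)
Definition zind (w : config) (s : node Dmax) (k : 'I_K) : bool :=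
  if insub s is Some l then val (tagged w l) k else false.

End LatentTree.

Local Open Scope classical_set_scope.

Section Densities.
Variable R : realType.

Definition dot m (v w : 'cV[R]_m) : R := (v^T *m w) ord0 ord0.

Definition posdef m (A : 'M[R]_m) : Prop :=
  A^T = A /\ forall v : 'cV[R]_m, v != 0 -> 0 < dot v (A *m v).

(* N(y | m, v) with v the variance; [normal_pdf] takes the standard
   deviation. *)
Definition normal_density (m v y : R) : R := normal_pdf m (Num.sqrt v) y.

Definition mvnormal_density m (mu : 'cV[R]_m) (Sigma : 'M[R]_m)
    (v : 'cV[R]_m) : R :=
  (Num.sqrt ((2 * pi) ^+ m * \det Sigma))^-1 *
  expR (- (2^-1 * dot (v - mu) (invmx Sigma *m (v - mu)))).

Definition Gamma_fun (a : R) : R :=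
  \int[lebesgue_measure]_(t in `]0, +oo[) (t `^ (a - 1) * expR (- t)).

Definition gamma_density (a b t : R) : R :=
  b `^ a / Gamma_fun a * t `^ (a - 1) * expR (- (b * t)).

Definition dirichlet_density K (alpha p : 'I_K -> R) : R :=
  Gamma_fun (\sum_k alpha k) / (\prod_k Gamma_fun (alpha k)) *
  \prod_k p k `^ (alpha k - 1).

Definition sigmoid (y : R) : R := (1 + expR (- y))^-1.

Definition jj_lambda (xi : R) : R :=
  if xi == 0 then 8^-1 else (2 * xi)^-1 * (sigmoid xi - 2^-1).

Definition is_pmf (T : finType) (p : T -> R) : Prop :=
  (forall y, 0 <= p y) /\ \sum_y p y = 1.

End Densities.

Section ParameterSpace.
Variable R : realType.

(* The product sigma-algebra: generated by the real coordinates [f \in F]. *)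
Definition gen_coords T (F : set (T -> R)) : set (set T) :=
  [set f @^-1` B | f in F & B in [set B : set R | measurable B]].

(* (theta, tau) *)
Record comps (D K : nat) := Comps {
  theta : 'I_K -> 'cV[R]_D.+1;
  tau : 'I_K -> R;
  tau_gt0 : forall k, 0 < tau k }.

HB.instance Definition _ D K := gen_eqMixin (comps D K).
HB.instance Definition _ D K := gen_choiceMixin (comps D K).
Definition comps0 D K : comps D K :=
  @Comps D K (fun=> 0) (fun=> 1) (fun=> ltr01).
HB.instance Definition _ D K := isPointed.Build (comps D K) (comps0 D K).

Definition comps_coords D K : set (set (comps D K)) :=
  gen_coords (range (fun kj : 'I_K * 'I_D.+1 => fun c => theta c kj.1 kj.2 ord0)
    `|` range (fun k : 'I_K => fun c => tau c k)).

Definition comps_space D K := g_sigma_algebraType (@comps_coords D K).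

(* Probability vectors of length K; [K_gt0] provides the point that every
   measurable type must have. *)
Record probvec (K : nat) (K_gt0 : (0 < K)%N) := Probvec {
  pv : 'I_K -> R;
  pv_ge0 : forall k, 0 <= pv k;
  pv_sum : \sum_k pv k = 1 }.

Lemma unitvec_ge0 K (K_gt0 : (0 < K)%N) k : 0 <= (k == Ordinal K_gt0)%:R :> R.
Proof. exact: ler0n. Qed.

Lemma unitvec_sum K (K_gt0 : (0 < K)%N) :
  \sum_k (k == Ordinal K_gt0)%:R = 1 :> R.
Proof.
rewrite (bigD1 (Ordinal K_gt0)) //= big1 ?addr0 // => k.
by move/negPf ->.
Qed.

HB.instance Definition _ K (K_gt0 : (0 < K)%N) := gen_eqMixin (probvec K_gt0).
HB.instance Definition _ K (K_gt0 : (0 < K)%N) :=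
  gen_choiceMixin (probvec K_gt0).
Definition probvec0 K (K_gt0 : (0 < K)%N) : probvec K_gt0 :=
  Probvec K_gt0 (unitvec_ge0 K_gt0) (unitvec_sum K_gt0).
HB.instance Definition _ K (K_gt0 : (0 < K)%N) :=
  isPointed.Build (probvec K_gt0) (probvec0 K_gt0).

Definition probvec_coords K (K_gt0 : (0 < K)%N) : set (set (probvec K_gt0)) :=
  gen_coords (range (fun k : 'I_K => fun p => pv p k)).

Definition probvec_space K (K_gt0 : (0 < K)%N) :=
  g_sigma_algebraType (@probvec_coords K K_gt0).

Definition betas_coords Dmax : set (set (inner Dmax -> 'cV[R]_2)) :=
  gen_coords (range (fun sj : inner Dmax * 'I_2 =>
    fun beta : inner Dmax -> 'cV[R]_2 => beta sj.1 sj.2 ord0)).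

Definition betas_space Dmax := g_sigma_algebraType (@betas_coords Dmax).

Definition plane_coords : set (set 'cV[R]_2) :=
  gen_coords (range (fun j : 'I_2 => fun v : 'cV[R]_2 => v j ord0)).

Definition plane := g_sigma_algebraType plane_coords.

(* ((theta, tau), pi, beta) *)
Definition params Dmax D K (K_gt0 : (0 < K)%N) : Type :=
  (comps_space D K * probvec_space K_gt0 * betas_space Dmax)%type.

End ParameterSpace.

Section Marginals.
Variables (R : realType) (Dmax D K : nat) (K_gt0 : (0 < K)%N).

Definition comps_of (y : params R Dmax D K_gt0) : comps_space R D K := y.1.1.
Definition pi_of (y : params R Dmax D K_gt0) : 'I_K -> R := pv y.1.2.
Definition beta_of (s : inner Dmax) (y : params R Dmax D K_gt0) : plane R :=
  y.2 s.

Lemma measurable_comps_of : measurable_fun setT comps_of.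
Proof.
exact: (measurableT_comp (@measurable_fst _ _ _ _) (@measurable_fst _ _ _ _)).
Qed.

Lemma measurable_beta_of s : measurable_fun setT (beta_of s).
Proof.
have me : measurable_fun setT (fun be : betas_space R Dmax => be s : plane R).
  apply: (@measurability _ _ (betas_space R Dmax) (plane R) setT
    (fun be : betas_space R Dmax => be s) (@plane_coords R)) => //.
  move=> _ [_ [_ [j _ <-]] [B mB <-] <-].
  rewrite setTI; apply: sub_gen_smallest.
  by exists (fun be : inner Dmax -> 'cV[R]_2 => be s j ord0);
    [exists (s, j) | exists B].
exact: (measurableT_comp me (@measurable_snd _ _ _ _)).
Qed.

HB.instance Definition _ :=
  isMeasurableFun.Build _ _ _ _ comps_of measurable_comps_of.
HB.instance Definition _ s :=
  isMeasurableFun.Build _ _ _ _ (beta_of s) (measurable_beta_of s).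

Variable q : probability (params R Dmax D K_gt0) R.

(* q(theta, tau) and q(beta_s) *)
Definition q_comps : probability (comps_space R D K) R :=
  distribution q comps_of.
Definition q_beta (s : inner Dmax) : probability (plane R) R :=
  distribution q (beta_of s).

End Marginals.

Record model (R : realType) (Dmax D K : nat) := Model {
  g : node Dmax -> R;
  g_ge0 : forall s, 0 <= g s;
  g_le1 : forall s, g s <= 1;
  g_leaf : forall s, is_leaf s -> g s = 0;
  alpha : 'I_K -> R;
  alpha_gt0 : forall k, 0 < alpha k;
  mu : 'cV[R]_D.+1;
  Lambda : 'M[R]_D.+1;
  Lambda_posdef : posdef Lambda;
  gam_shape : R;
  gam_shape_gt0 : 0 < gam_shape;
  gam_rate : R;
  gam_rate_gt0 : 0 < gam_rate;
  eta : inner Dmax -> 'cV[R]_2;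
  L : inner Dmax -> 'M[R]_2;
  L_posdef : forall s, posdef (L s) }.

Definition branches (Dmax n : nat) := {ffun 'I_n -> Dmax.-tuple bool}.

Section Model.
Variables (R : realType) (Dmax D K n : nat) (K_gt0 : (0 < K)%N).
Variable M : model R Dmax D K.
(* The data x_{1-D}, ..., x_n are the values of [x] at these integers; the
   index [t : 'I_n] stands for the time t + 1. *)
Variable x : int -> R.
Variable xi : inner Dmax -> 'I_n -> R.

Local Notation params := (params R Dmax D K_gt0).
Local Notation config := (config Dmax K).
Local Notation branches := (branches Dmax n).

Definition time (t : 'I_n) : int := t.+1%:Z.

(* [x_{t-1}, ..., x_{t-D}, 1]^T *)
Definition xtilde (t : 'I_n) : 'cV[R]_D.+1 :=
  \col_j (if (j < D)%N then x (time t - j.+1%:Z) else 1).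

(* [t, 1]^T *)
Definition ttilde (t : 'I_n) : 'cV[R]_2 :=
  \col_j (if j == 0 then (time t)%:~R else 1).

Definition emission (t : 'I_n) (c : comps R D K) (k : 'I_K) : R :=
  normal_density (dot (xtilde t) (theta c k)) (tau c k)^-1 (x (time t)).

Definition p_x (u : branches) (w : config) (c : comps R D K) : R :=
  \prod_t \prod_(s in leaves (tag w)) \prod_k
    emission t c k ^+ (zind w s k * ancestor s (leaf_of (u t))).

Definition p_z (p : 'I_K -> R) (w : config) : R :=
  \prod_(s in leaves (tag w)) \prod_k p k ^+ zind w s k.

Definition p_T (T : subtree Dmax) : R :=
  (\prod_(s in inners T) g M (val s)) * \prod_(s in leaves T) (1 - g M s).

Definition p_pi (p : 'I_K -> R) : R := dirichlet_density (alpha M) p.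

Definition p_comps (c : comps R D K) : R :=
  \prod_k (mvnormal_density (mu M) (invmx (tau c k *: Lambda M)) (theta c k) *
           gamma_density (gam_shape M) (gam_rate M) (tau c k)).

Definition p_beta (beta : inner Dmax -> 'cV[R]_2) : R :=
  \prod_s mvnormal_density (eta M s) (invmx (L M s)) (beta s).

Definition h_node (b : bool) (v : 'cV[R]_2) (xi_st : R) (t : 'I_n) : R :=
  sigmoid xi_st *
  expR (dot v (ttilde t) * b%:R - 2^-1 * (dot v (ttilde t) + xi_st)
        - jj_lambda xi_st * (dot v (ttilde t) ^+ 2 - xi_st ^+ 2)).

(* [nth false (u t) (size s)] is u_{t,d_s}. *)
Definition h (u : branches) (beta : inner Dmax -> 'cV[R]_2) : R :=
  \prod_t \prod_(s : inner Dmax)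
    h_node (nth false (u t) (size (val s))) (beta s) (xi s t) t
      ^+ ancestor (val s) (leaf_of (u t)).

Definition joint (u : branches) (w : config) (y : params) : R :=
  p_x u w (comps_of y) * p_z (pi_of y) w * p_T (tag w) * p_pi (pi_of y) *
  p_comps (comps_of y).

(* ln (p(x, z, T, theta, tau, pi | u) h(u | beta, xi) p(beta)) as the sum of its
   log-factors. Only the factors not involving u can vanish, so that the
   convention [ln 0 = 0] bears on terms constant in u only. *)
Definition log_joint (u : branches) (w : config) (y : params) : R :=
  ln (p_x u w (comps_of y)) + ln (p_z (pi_of y) w) + ln (p_T (tag w)) +
  ln (p_pi (pi_of y)) + ln (p_comps (comps_of y)) + ln (h u y.2) +
  ln (p_beta y.2).

Lemma log_jointE u w y :
  0 < p_x u w (comps_of y) -> 0 < p_z (pi_of y) w -> 0 < p_T (tag w) ->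
  0 < p_pi (pi_of y) -> 0 < p_comps (comps_of y) -> 0 < h u y.2 ->
  0 < p_beta y.2 ->
  log_joint u w y = ln (joint u w y * h u y.2 * p_beta y.2).
Proof.
rewrite /log_joint /joint.
move: (p_x u w _) (p_z _ w) (p_T _) (p_pi _) (p_comps _) (h u _) (p_beta _).
move=> r1 r2 r3 r4 r5 r6 r7 r1_gt0 *.
by rewrite !lnM ?posrE //; repeat (apply: mulr_gt0 => //).
Qed.

Section Update.
Variable qzT : config -> R.

(* Integrability and expectation with respect to the product of q(z, T) and a
   probability measure P; configurations of probability 0 are irrelevant. *)
Definition integrable_zT d (Y : measurableType d) (P : probability Y R)
    (f : config -> Y -> R) : Prop :=
  forall w, qzT w != 0 -> P.-integrable setT (EFin \o f w).

Definition expect_zT d (Y : measurableType d) (P : probability Y R)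
    (f : config -> Y -> R) : R :=
  \sum_w qzT w * \int[P]_y f w y.

Variable q : probability params R.

(* ln q(u) = E[ln joint] + const: [C] collects the log-factors not involving u
   which are absorbed into the constant before taking expectations (they need
   not be integrable), and [c] is the remaining normalizing constant. *)
Definition is_variational_update (qu : branches -> R) : Prop :=
  exists (C : config -> params -> R) (c : R), forall u,
    [/\ 0 < qu u,
        integrable_zT q (fun w y => log_joint u w y - C w y) &
        ln (qu u) = expect_zT q (fun w y => log_joint u w y - C w y) + c].

Definition log_h (t : 'I_n) (s : inner Dmax) (b : bool) (v : plane R) : R :=
  ln (h_node b v (xi s t) t).

(* I{s \in L_T} \sum_k z_{s,k} ln N(x_t | xtilde_t^T theta_k, tau_k^-1) *)
Definition log_emission (t : 'I_n) (s : node Dmax) (w : config)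
    (c : comps_space R D K) : R :=
  (s \in leaves (tag w))%:R * \sum_k (zind w s k)%:R * ln (emission t c k).

Definition finite_expectations : Prop :=
  forall t s b,
    (q_beta q s).-integrable setT (EFin \o log_h t s b) /\
    integrable_zT (q_comps q) (log_emission t (child s b)).

Definition A_term (t : 'I_n) (s : inner Dmax) (b : bool) : R :=
  \int[q_beta q s]_v log_h t s b v +
  expect_zT (q_comps q) (log_emission t (child s b)).

End Update.
End Model.

Section Rho.
Variables (R : realType) (Dmax : nat) (a : inner Dmax -> bool -> R).

Fixpoint rho_rec (m : nat) (s : inner Dmax) (b : bool) : R :=
  if m is m'.+1 then
    if insub (child s b) is Some s' then
      expR (a s b + ln (\sum_b' rho_rec m' s' b'))
    else expR (a s b)
  else expR (a s b).

(* [rho s b] is attached to the node s_b = [child s b]; Dmax bounds the number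
   of recursive calls, see [ln_rho_inner] and [ln_rho_leaf]. *)
Definition rho (s : inner Dmax) (b : bool) : R := rho_rec Dmax s b.

Definition varpi (s : inner Dmax) (b : bool) : R := rho s b / \sum_b' rho s b'.

Lemma rho_gt0 s b : 0 < rho s b.
Proof.
by rewrite /rho; case: {1}Dmax => [|m] /=; [|case: insubP => *];
  exact: expR_gt0.
Qed.

Lemma rho_rec_fuel m m' (s : inner Dmax) b :
  (Dmax - size (val s) <= m.+1)%N -> (Dmax - size (val s) <= m'.+1)%N ->
  rho_rec m s b = rho_rec m' s b.
Proof.
elim: m m' s b => [|m IHm] [|m'] s b //= sm sm'.
- case: insubP => //= s' s'_inner.
  by move: s'_inner; rewrite /is_inner /= size_rcons => ? _; exfalso; lia.
- case: insubP => //= s' s'_inner.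
  by move: s'_inner; rewrite /is_inner /= size_rcons => ? _; exfalso; lia.
- case: insubP => //= s' _ s'E; congr (expR (_ + ln _)).
  apply: eq_bigr => b' _; apply: IHm;
  have -> : val s' = child s b by []; rewrite /= size_rcons; lia.
Qed.

Lemma ln_rho_inner (s : inner Dmax) b (sb_inner : is_inner (child s b)) :
  ln (rho s b) = a s b + ln (\sum_b' rho (exist _ (child s b) sb_inner) b').
Proof.
have sD : (size (val s) < Dmax)%N := valP s.
rewrite /rho (@rho_rec_fuel Dmax Dmax.+1) /=; [|lia..].
by rewrite insubT /= expRK.
Qed.

Lemma ln_rho_leaf s b : is_leaf (child s b) -> ln (rho s b) = a s b.
Proof.
move=> /eqP sb_leaf; rewrite /rho; case: {1}Dmax => [|m] /=.
  by rewrite expRK.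
by case: insubP => [s' +|_]; rewrite ?expRK // /is_inner sb_leaf ltnn.
Qed.

End Rho.

Definition q_marginal (R : realType) (Dmax n : nat) (qu : branches Dmax n -> R)
    (t : 'I_n) (v : Dmax.-tuple bool) : R :=
  \sum_(u : branches Dmax n | u t == v) qu u.

(* Main.v *)
(* Up to a term constant in [u], the exponent of [qu u] is the sum over t of the
   A_{t,s,b} along the path from the root to the leaf [u t], so [qu] is
   proportional to the product over t of the exponentials of these path sums.
   Telescoping along the path turns each exponential into the product of the
   varpi, up to the factor given by the sum of the rho at the root. Since the two
   varpi at every inner node add up to 1, their path products add up to 1 over
   the leaves, and so all the normalizing constants cancel. *)
Require Import Defs.
From mathcomp Require Import all_boot all_order all_algebra.
From mathcomp Require Import all_classical all_reals all_analysis.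
From mathcomp Require Import measurable_realfun ring.
Import Order.TTheory GRing.Theory Num.Theory.
Import numFieldNormedType.Exports.
Local Open Scope ring_scope.

(** * Root-to-leaf paths, and products and sums along them *)

Section Paths.
Set Implicit Arguments.
Unset Strict Implicit.
Variable Dmax : nat.
Implicit Types v : Dmax.-tuple bool.

Lemma size_take_tuple v (i : 'I_Dmax.+1) : size (take i v) = i.
Proof. by rewrite size_takel // size_tuple -ltnS. Qed.

Lemma path_node_subproof v (i : 'I_Dmax.+1) : (size (take i v) <= Dmax)%N.
Proof. by rewrite size_take_tuple -ltnS. Qed.

(** Path nodes are indexed by depth. Depth [Dmax] is the leaf itself, hence one index more here than
    in [path_inner]. *)
Definition path_node v (i : 'I_Dmax.+1) : node Dmax :=
  Bseq (path_node_subproof v i).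

Lemma path_inner_subproof v (i : 'I_Dmax) :
  is_inner (path_node v (widen_ord (leqnSn Dmax) i)).
Proof. by rewrite /is_inner /= (size_take_tuple v (widen_ord _ i)) /=. Qed.

Definition path_inner v (i : 'I_Dmax) : inner Dmax :=
  exist (fun s : node Dmax => is_inner s) _ (path_inner_subproof v i).

Lemma size_path_inner v i : size (val (path_inner v i)) = i.
Proof. exact: (size_take_tuple v (widen_ord _ i)). Qed.

Lemma child_path_inner v i :
  child (path_inner v i) (tnth v i) = path_node v (lift ord0 i).
Proof.
apply: val_inj; rewrite /= /bump /= add1n (tnth_nth false) -take_nth //.
by rewrite size_tuple.
Qed.

Lemma path_node0 v : path_node v ord0 = Defs.root Dmax.
Proof. by apply: val_inj; rewrite /= take0. Qed.

Lemma path_inner0 v (Dmax_gt0 : (0 < Dmax)%N) :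
  path_inner v (Ordinal Dmax_gt0) = exist _ (Defs.root Dmax) Dmax_gt0.
Proof. by do 2!apply: val_inj; rewrite /= take0. Qed.

(** The ancestors of a leaf are its prefixes, exactly one per depth, so taking the size and taking
    the prefix are inverse to each other. *)
Lemma big_ancestor_node T (idx : T) (op : Monoid.com_law idx) v
    (F : node Dmax -> T) :
  \big[op/idx]_(s | ancestor s (leaf_of v)) F s =
  \big[op/idx]_i F (path_node v i).
Proof.
have sz (s : node Dmax) : (size s < Dmax.+1)%N by rewrite ltnS size_bseq.
rewrite (reindex_onto (path_node v) (fun s => Ordinal (sz s))) => [|s]; last first.
  by rewrite /ancestor prefixE => /eqP sE; apply: val_inj.
apply: eq_bigl => i; rewrite /ancestor prefix_take.
by apply/eqP/val_inj; rewrite /= size_take_tuple.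
Qed.

Lemma big_ancestor_inner T (idx : T) (op : Monoid.com_law idx) v
    (F : inner Dmax -> T) :
  \big[op/idx]_(s : inner Dmax | ancestor (val s) (leaf_of v)) F s =
  \big[op/idx]_i F (path_inner v i).
Proof.
rewrite (reindex_onto (path_inner v) (fun s => Ordinal (valP s))) => [|s].
  apply: eq_bigl => i; rewrite /ancestor /= prefix_take.
  by apply/eqP/val_inj; rewrite /= (size_take_tuple v (widen_ord _ i)).
by rewrite /ancestor prefixE => /eqP sE; do 2!apply: val_inj.
Qed.

Lemma ancestor_child v s b :
  ancestor (child s b) (leaf_of v) =
  ancestor (val s) (leaf_of v) && (nth false v (size (val s)) == b).
Proof.
rewrite /ancestor !prefixE /= size_rcons (take_nth false); last first.
  by rewrite size_tuple; exact: (valP s).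
by rewrite eqseq_rcons.
Qed.

(** If [s] is on the path, exactly one of its children is, the one chosen by the bit of [v] at the
    depth of [s]; otherwise neither child is and the inner operation is over the empty set. *)
Lemma big_ancestor_child T (idx : T) (op : Monoid.com_law idx) v
    (F : inner Dmax -> bool -> T) :
  \big[op/idx]_(s : inner Dmax)
    \big[op/idx]_(b | ancestor (child s b) (leaf_of v)) F s b =
  \big[op/idx]_i F (path_inner v i) (tnth v i).
Proof.
rewrite (eq_bigr (fun s : inner Dmax => if ancestor (val s) (leaf_of v)
    then F s (nth false v (size (val s))) else idx)) => [|s _]; last first.
  under eq_bigl do rewrite ancestor_child.
  case: ifP => _ /=; last by rewrite big_pred0.
  by rewrite (big_pred1 (nth false v (size (val s)))) // => b; rewrite eq_sym.
rewrite -big_mkcond big_ancestor_inner; apply: eq_bigr => i _.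
by rewrite size_path_inner (tnth_nth false).
Qed.

Lemma prod_ancestor_child (A : comPzSemiRingType) v
    (F : inner Dmax -> bool -> A) :
  \prod_(s : inner Dmax) \prod_(b : bool)
    F s b ^+ ancestor (child s b) (leaf_of v) =
  \prod_i F (path_inner v i) (tnth v i).
Proof.
rewrite -big_ancestor_child; apply: eq_bigr => s _.
by rewrite [RHS]big_mkcond; apply: eq_bigr => b _; case: ifP.
Qed.

Lemma prod_ancestor_inner (A : comPzSemiRingType) v
    (F : inner Dmax -> bool -> A) :
  \prod_(s : inner Dmax)
    F s (nth false v (size (val s))) ^+ ancestor (val s) (leaf_of v) =
  \prod_i F (path_inner v i) (tnth v i).
Proof.
transitivity (\prod_(s : inner Dmax | ancestor (val s) (leaf_of v))
    F s (nth false v (size (val s)))).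
  by rewrite [RHS]big_mkcond; apply: eq_bigr => s _; case: ifP.
rewrite big_ancestor_inner; apply: eq_bigr => i _.
by rewrite size_path_inner (tnth_nth false).
Qed.

(** Induction that splits off the first branch [b]: the choices below it see the weights
    [P (b :: l)], again of total 1 at each prefix, so only the sum of [P [::] b] remains. Letting
    [P] depend on the whole prefix makes this shift possible. *)
Lemma sum_prod_tuple (A : comPzSemiRingType) m (P : seq bool -> bool -> A) :
  (forall l, (size l < m)%N -> \sum_b P l b = 1) ->
  \sum_(v : m.-tuple bool) \prod_(i < m) P (take i v) (tnth v i) = 1.
Proof.
elim: m P => [|m IHm] P P1.
  rewrite (big_pred1 [tuple]) => [|v]; last by rewrite /= [v]tuple0; exact/esym/eqP.
  by rewrite big_ord0.
rewrite (reindex (fun bv : bool * m.-tuple bool =>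
  [tuple of bv.1 :: bv.2])) /=; last first.
  exists (fun v : m.+1.-tuple bool => (thead v, [tuple of behead v])) => [[b v] _|v _] /=.
    by rewrite theadE; congr (_, _); apply: val_inj.
  by rewrite -tuple_eta.
rewrite -(pair_bigA _ (fun b (v : m.-tuple bool) => \prod_(i < m.+1)
    P (take i [tuple of b :: v]) (tnth [tuple of b :: v] i))) /=.
rewrite -[RHS](P1 [::]) //; apply: eq_bigr => b _.
under eq_bigr => v _.
  rewrite big_ord_recl /= tnth0.
  under eq_bigr do rewrite tnthS.
  over.
rewrite -big_distrr /= (IHm (fun l => P (b :: l))) ?mulr1 // => l sl.
exact: P1.
Qed.

Lemma sum_prod_path (A : comPzSemiRingType) (F : inner Dmax -> bool -> A) :
  (forall s, \sum_b F s b = 1) ->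
  \sum_v \prod_i F (path_inner v i) (tnth v i) = 1.
Proof.
move=> F1.
(* [F] is extended to all sequences of branch choices as a sum over the at most
   one inner node given by the sequence. *)
pose P l b := \sum_(s : inner Dmax | val (val s) == l) F s b.
have PE s b : P (val (val s)) b = F s b.
  by apply: big_pred1 => s'; rewrite /= !val_eqE.
rewrite -[RHS](@sum_prod_tuple A Dmax P) => [|l sl].
  by apply: eq_bigr => v _; apply: eq_bigr => i _; rewrite -PE.
pose s : inner Dmax := exist _ (Bseq (ltnW sl)) sl.
by rewrite -[RHS](F1 s); apply: eq_bigr => b _; rewrite -PE.
Qed.

End Paths.

(** * Telescoping of the branch probabilities along a path *)

Section Telescoping.
Set Implicit Arguments.
Unset Strict Implicit.
Variables (R : realType) (Dmax : nat) (a : inner Dmax -> bool -> R).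

Lemma sum_rho_gt0 s : 0 < \sum_b rho a s b.
Proof. by rewrite big_bool /= addr_gt0 ?rho_gt0. Qed.

Lemma sum_varpi s : \sum_b varpi a s b = 1.
Proof. by rewrite -big_distrl /= divff // gt_eqF ?sum_rho_gt0. Qed.

Lemma rho_inner (s : inner Dmax) b (sb_inner : is_inner (child s b)) :
  rho a s b = expR (a s b) * \sum_b' rho a (exist _ (child s b) sb_inner) b'.
Proof.
rewrite -[LHS]lnK ?posrE ?rho_gt0 // ln_rho_inner expRD lnK //.
by rewrite posrE sum_rho_gt0.
Qed.

Lemma rho_leaf (s : inner Dmax) b : is_leaf (child s b) -> rho a s b = expR (a s b).
Proof.
by move=> sb_leaf; rewrite -[LHS]lnK ?posrE ?rho_gt0 // ln_rho_leaf.
Qed.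

(* The numerator of [varpi] at depth [i] is [expR a] times its denominator at
   depth [i.+1], so that the product over a path telescopes. *)
Lemma prod_varpi (Dmax_gt0 : (0 < Dmax)%N) (v : Dmax.-tuple bool) :
  \prod_i varpi a (path_inner v i) (tnth v i) =
  expR (\sum_i a (path_inner v i) (tnth v i)) /
  \sum_b rho a (exist _ (Defs.root Dmax) Dmax_gt0) b.
Proof.
(* [f i] is the denominator of [varpi] at depth [i]. The default 1 is reached at [i = Dmax], where
   the recursion for [rho] has no sum over children, so one formula covers the last branch too. *)
pose f i := if insub i is Some j then \sum_b rho a (path_inner v j) b else 1.
have f_neq0 i : f i != 0.
  by rewrite /f; case: insub => [j|]; rewrite ?oner_eq0 // gt_eqF ?sum_rho_gt0.
have varpiE (i : 'I_Dmax) : varpi a (path_inner v i) (tnth v i) =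
    expR (a (path_inner v i) (tnth v i)) * (f i.+1 / f i).
  rewrite mulrA /varpi; congr (_ / _); last by rewrite /f valK.
  rewrite /f; case: insubP => [j _ jE|].
    have sb_inner : is_inner (child (path_inner v i) (tnth v i)).
      rewrite child_path_inner /is_inner size_take_tuple lift0.
      by have := ltn_ord j; rewrite [nat_of_ord j]jE.
    rewrite rho_inner; congr (_ * _); apply: eq_bigr => b _; congr (rho _ _ _).
    by do 2!apply: val_inj; rewrite /= jE (tnth_nth false) -take_nth // size_tuple.
  rewrite -leqNgt => Di; rewrite mulr1 rho_leaf // child_path_inner /is_leaf.
  by rewrite size_take_tuple lift0 eqn_leq Di ltn_ord.
under eq_bigr do rewrite varpiE.
rewrite big_split /= -expR_sum; congr (_ * _).
(* What survives is [f Dmax / f 0], the inverse of the sum of [rho] at the root. *)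
rewrite -(big_mkord xpredT (fun i => f i.+1 / f i)) telescope_prodf //.
rewrite /f insubF ?ltnn // mul1r; congr (_^-1).
by rewrite (insubT (fun i => i < Dmax)%N Dmax_gt0) /= path_inner0.
Qed.

End Telescoping.

(** * Integration against marginals, and finite sums of integrals *)

Section Integration.
Set Implicit Arguments.
Unset Strict Implicit.
Local Open Scope classical_set_scope.
Context d d' (T : measurableType d) (T' : measurableType d') (R : realType).
Variable P : probability T R.

(** Change of variables for the absolute value of [f]. It carries the finiteness assumed for the
    marginals over to the joint distribution. *)
Lemma integrable_distribution (X : {mfun T >-> T'}) (f : T' -> R) :
  (distribution P X).-integrable setT (EFin \o f) ->
  P.-integrable setT (EFin \o (f \o X)).
Proof.
move=> /integrableP[mf fi]; apply/integrableP; split.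
  by apply/measurable_EFinP; apply: measurableT_comp => //; exact/measurable_EFinP.
move: fi; rewrite ge0_integral_distribution //.
by apply: measurableT_comp.
Qed.

Lemma Rintegral_distribution (X : {mfun T >-> T'}) (f : T' -> R) :
  (distribution P X).-integrable setT (EFin \o f) ->
  \int[distribution P X]_y f y = \int[P]_y f (X y).
Proof.
move=> fi; rewrite /Rintegral; congr fine.
rewrite (integral_distribution (f := EFin \o f)) //.
  by case/integrableP : fi.
exact: integrable_distribution.
Qed.

Lemma integrable_EFin_sum (I : finType) (f : I -> T -> R) :
  (forall i, P.-integrable setT (EFin \o f i)) ->
  P.-integrable setT (EFin \o (fun y => \sum_i f i y)).
Proof.
move=> fi.
rewrite (_ : _ \o _ = fun y => (\sum_i (EFin \o f i) y)%E).
  exact: integrable_sum.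
by apply/funext => y /=; rewrite sumEFin.
Qed.

Lemma Rintegral_sum (I : finType) (f : I -> T -> R) :
  (forall i, P.-integrable setT (EFin \o f i)) ->
  \int[P]_y (\sum_i f i y) = \sum_i \int[P]_y f i y.
Proof.
move=> fi; rewrite /Rintegral.
under eq_integral do rewrite -sumEFin.
rewrite (@integral_sum _ _ _ P setT _ I (fun i => EFin \o f i)) //.
by rewrite -sum_fine // => i _; exact: integrable_fin_num.
Qed.

End Integration.

(** * The log-joint as a sum over paths, and its expectation *)

Section LogFactors.
Set Implicit Arguments.
Unset Strict Implicit.
Variables (R : realType) (Dmax D K n : nat) (K_gt0 : (0 < K)%N).
Variables (M : model R Dmax D K) (x : int -> R) (xi : inner Dmax -> 'I_n -> R).
Implicit Types (t : 'I_n) (u : branches Dmax n) (w : config Dmax K).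
Implicit Types (v : Dmax.-tuple bool) (y : params R Dmax D K_gt0).

Lemma emission_gt0 t (c : comps R D K) k : 0 < emission x t c k.
Proof.
have tau0 : Num.sqrt (tau c k)^-1 != 0.
  by rewrite gt_eqF // sqrtr_gt0 invr_gt0 tau_gt0.
by rewrite /emission /normal_density normal_pdfE // mulr_gt0 ?normal_peak_gt0 ?expR_gt0.
Qed.

Lemma h_node_gt0 b (z : 'cV[R]_2) r t : 0 < h_node b z r t.
Proof.
by rewrite mulr_gt0 ?expR_gt0 // invr_gt0 addr_gt0 ?expR_gt0.
Qed.

(** After exponentiation, membership in the leaves of the subtree and membership in the path both
    become conditions on a product over all nodes, so the subtree leaf on the path need not be
    located. *)
Lemma ln_p_x u w (c : comps R D K) :
  ln (p_x x u w c) = \sum_t \sum_i log_emission x t (path_node (u t) i) w c.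
Proof.
rewrite -[RHS]expRK; congr ln; rewrite expR_sum; apply: eq_bigr => t _.
rewrite -(big_ancestor_node _ (u t) (fun s => log_emission x t s w c)).
rewrite expR_sum big_mkcond [RHS]big_mkcond; apply: eq_bigr => s _.
rewrite /log_emission; case: ifP => s_leaf; last by rewrite !mul0r expR0 if_same.
rewrite mul1r expR_sum; case: ifP => _; last first.
  by rewrite big1 // => k _; rewrite muln0.
apply: eq_bigr => k _.
by rewrite muln1 expRM_natl lnK // posrE emission_gt0.
Qed.

Lemma ln_h u (beta : inner Dmax -> 'cV[R]_2) :
  ln (h xi u beta) = \sum_t \sum_i
    log_h xi t (path_inner (u t) i) (tnth (u t) i) (beta (path_inner (u t) i)).
Proof.
rewrite -[RHS]expRK; congr ln; rewrite expR_sum; apply: eq_bigr => t _.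
rewrite (prod_ancestor_inner (u t) (fun s b => h_node b (beta s) (xi s t) t)).
rewrite expR_sum; apply: eq_bigr => i _.
by rewrite /log_h lnK // posrE h_node_gt0.
Qed.

Definition log_node t (s : inner Dmax) (b : bool) w y : R :=
  log_h xi t s b (beta_of s y) + log_emission x t (child s b) w (comps_of y).

(* The emission at the root does not depend on the branch choices, which is why
   it contributes to no [A_term]. *)
Definition log_path u w y : R :=
  \sum_t \sum_i log_node t (path_inner (u t) i) (tnth (u t) i) w y.

Definition log_rest w y : R :=
  ln (p_z (Defs.pi_of y) w) + ln (p_T M (tag w)) + ln (p_pi M (Defs.pi_of y)) +
  ln (p_comps M (comps_of y)) + ln (p_beta M y.2) +
  \sum_(t < n) log_emission x t (Defs.root Dmax) w (comps_of y).

Lemma log_joint_path u w y :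
  log_joint M x xi u w y = log_path u w y + log_rest w y.
Proof.
rewrite /log_joint ln_p_x ln_h /log_path /log_node.
rewrite (eq_bigr (fun t => log_emission x t (Defs.root Dmax) w (comps_of y) +
    \sum_i log_emission x t (child (path_inner (u t) i) (tnth (u t) i)) w
      (comps_of y))) => [|t _]; last first.
  rewrite big_ord_recl path_node0; congr (_ + _).
  by apply: eq_bigr => i _; rewrite child_path_inner.
under [in RHS]eq_bigr do rewrite big_split /=.
rewrite !big_split /= /log_rest.
set p1 := ln _; set p2 := ln _; set p3 := ln _; set p4 := ln _; set p5 := ln _.
set e0 := bigop _ _ _; set e1 := bigop _ _ _; set e2 := bigop _ _ _.
by ring.
Qed.

Section Expectation.
Variables (qzT : config Dmax K -> R) (q : probability (params R Dmax D K_gt0) R).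
Hypotheses (qzT1 : \sum_w qzT w = 1).
Hypothesis fin : finite_expectations x xi qzT q.

Lemma integrable_log_h t s b :
  q.-integrable setT (EFin \o (fun y => log_h xi t s b (beta_of s y))).
Proof. by apply: integrable_distribution; have [] := fin t s b. Qed.

Lemma integrable_log_emission t s b w : qzT w != 0 ->
  q.-integrable setT
    (EFin \o (fun y => log_emission x t (child s b) w (comps_of y))).
Proof.
by move=> w0; apply: integrable_distribution; have [_] := fin t s b; apply.
Qed.

Lemma integrable_log_node t s b w : qzT w != 0 ->
  q.-integrable setT (EFin \o log_node t s b w).
Proof.
move=> w0; exact: integrableD (integrable_log_h _ _ _)
  (integrable_log_emission _ _ _ w0).
Qed.

Lemma expect_zTD (f1 f2 : config Dmax K -> params R Dmax D K_gt0 -> R) :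
  integrable_zT qzT q f1 -> integrable_zT qzT q f2 ->
  expect_zT qzT q (fun w y => f1 w y + f2 w y) =
  expect_zT qzT q f1 + expect_zT qzT q f2.
Proof.
move=> i1 i2; rewrite -big_split /=; apply: eq_bigr => w _.
(* At weight 0 nothing is known about integrability, but the term vanishes. *)
have [->|w0] := eqVneq (qzT w) 0; first by rewrite !mul0r addr0.
by rewrite -mulrDr RintegralD //; [exact: i1|exact: i2].
Qed.

Lemma integrable_zT_sum (I : finType)
    (f : I -> config Dmax K -> params R Dmax D K_gt0 -> R) :
  (forall i, integrable_zT qzT q (f i)) ->
  integrable_zT qzT q (fun w y => \sum_i f i w y).
Proof.
by move=> fi w w0; apply: (integrable_EFin_sum (f := fun i => f i w)) => i; apply: fi.
Qed.

Lemma expect_zT_sum (I : finType)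
    (f : I -> config Dmax K -> params R Dmax D K_gt0 -> R) :
  (forall i, integrable_zT qzT q (f i)) ->
  expect_zT qzT q (fun w y => \sum_i f i w y) = \sum_i expect_zT qzT q (f i).
Proof.
move=> fi; rewrite exchange_big /=; apply: eq_bigr => w _.
have [->|w0] := eqVneq (qzT w) 0.
  by rewrite mul0r big1 // => i _; rewrite mul0r.
rewrite -big_distrr /= (Rintegral_sum (f := fun i => f i w)) // => i.
exact: fi.
Qed.

(** The [log_h] part does not depend on [w], so the weights [qzT w] add up to 1 there; both
    integrals then pass from [q] to its marginals. *)
Lemma expect_log_node t s b :
  expect_zT qzT q (log_node t s b) = A_term x xi qzT q t s b.
Proof.
rewrite expect_zTD; last 2 first.
- by move=> w _; exact: integrable_log_h.
- by move=> w w0; exact: integrable_log_emission.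
rewrite /A_term; congr (_ + _).
  by rewrite /expect_zT -big_distrl /= qzT1 mul1r /q_beta Rintegral_distribution //;
    have [] := fin t s b.
apply: eq_bigr => w _; have [->|w0] := eqVneq (qzT w) 0; first by rewrite !mul0r.
by congr (_ * _); rewrite /q_comps Rintegral_distribution //;
  have [_] := fin t s b; apply.
Qed.

Lemma integrable_log_path u : integrable_zT qzT q (log_path u).
Proof.
by do 2!apply: integrable_zT_sum => ?; move=> w; exact: integrable_log_node.
Qed.

Lemma expect_log_path u :
  expect_zT qzT q (log_path u) = \sum_t \sum_i
    A_term x xi qzT q t (path_inner (u t) i) (tnth (u t) i).
Proof.
rewrite expect_zT_sum; last first.
  by move=> t; apply: integrable_zT_sum => i w; exact: integrable_log_node.
apply: eq_bigr => t _; rewrite expect_zT_sum => [|i w]; last exact: integrable_log_node.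
by apply: eq_bigr => i _; rewrite expect_log_node.
Qed.

Lemma variational_update_proportional (qu : branches Dmax n -> R) :
  is_variational_update M x xi qzT q qu ->
  exists c, forall u, qu u = expR c * \prod_t expR (\sum_i
    A_term x xi qzT q t (path_inner (u t) i) (tnth (u t) i)).
Proof.
move=> [C [c quE]].
(* [log_rest] and [C] need not be integrable separately; only their difference enters the
   expectation. *)
pose B w y := log_rest w y - C w y.
have joint_split u w y :
    log_joint M x xi u w y - C w y = log_path u w y + B w y.
  by rewrite log_joint_path -addrA.
have Bi : integrable_zT qzT q B.
  (* [B] is free of [u], so any one branch choice, here always left, gives it as a difference of two
     integrable functions. *)
  pose u0 : branches Dmax n := [ffun=> [tuple of nseq Dmax false]].
  move=> w w0; have [_ /(_ w w0) ji _] := quE u0.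
  have := integrableB measurableT ji (integrable_log_path u0 w0).
  apply: eq_integrable => // y _ /=.
  by rewrite joint_split EFinD addeAC subee ?add0e.
exists (expect_zT qzT q B + c) => u; have [qu_gt0 _ lnE] := quE u.
rewrite -expR_sum -expRD -[LHS]lnK ?posrE //; congr expR; rewrite lnE.
rewrite (_ : (fun w y => _) = fun w y => log_path u w y + B w y); last first.
  by apply/funext => w; apply/funext => y.
rewrite expect_zTD //; last exact: integrable_log_path.
by rewrite expect_log_path -addrA addrC.
Qed.

End Expectation.
End LogFactors.

(** * Total mass and marginals of a product distribution *)

Section Normalization.
Set Implicit Arguments.
Unset Strict Implicit.
Variables (A : comPzSemiRingType) (I V : finType) (Q : I -> V -> A).
Hypothesis Q1 : forall t, \sum_v Q t v = 1.

Lemma sum_prod_pmf : \sum_(u : {ffun I -> V}) \prod_t Q t (u t) = 1.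
Proof. by rewrite -bigA_distr_bigA big1. Qed.

Lemma marginal_prod_pmf t v :
  \sum_(u : {ffun I -> V} | u t == v) \prod_t' Q t' (u t') = Q t v.
Proof.
(* The constraint [u t == v] is moved into the factor at [t], which vanishes off [v]. The sum then
   runs over all functions and distributes over the product. *)
pose Qv t' v' := Q t' v' *+ ((t' == t) ==> (v' == v)).
transitivity (\sum_(u : {ffun I -> V}) \prod_t' Qv t' (u t')).
  rewrite big_mkcond; apply: eq_bigr => u _; case: eqP => [utv|/eqP utv].
    apply: eq_bigr => t' _; rewrite /Qv.
    by case: eqP => [->|] //=; rewrite utv ?eqxx.
  by rewrite (bigD1 t) //= /Qv eqxx /= (negPf utv) mul0r.
rewrite -bigA_distr_bigA (bigD1 t) //= [X in _ * X]big1 ?mulr1.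
  rewrite (bigD1 v) //= /Qv !eqxx big1 ?addr0 // => v' /negPf v'v.
  by rewrite v'v.
move=> t' /negPf t't; rewrite -[RHS](Q1 t').
by apply: eq_bigr => v' _; rewrite /Qv t't.
Qed.

End Normalization.

(** * Factorization of [qu] and the form of its factors *)

Theorem lemma1 (R : realType) (Dmax D K n : nat)
    (Dmax_gt0 : (0 < Dmax)%N) (K_gt0 : (0 < K)%N)
    (M : model R Dmax D K) (x : int -> R) (xi : inner Dmax -> 'I_n -> R)
    (qzT : config Dmax K -> R) (q : probability (params R Dmax D K_gt0) R)
    (qu : branches Dmax n -> R) :
  is_pmf qzT ->
  finite_expectations x xi qzT q ->
  is_pmf qu ->
  is_variational_update M x xi qzT q qu ->
  (forall u : branches Dmax n, qu u = \prod_t q_marginal qu t (u t)) /\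
  (forall (t : 'I_n) (v : Dmax.-tuple bool),
     q_marginal qu t v =
       \prod_(s : inner Dmax) \prod_(b : bool)
         varpi (A_term x xi qzT q t) s b ^+ ancestor (child s b) (leaf_of v)).
Proof.
move=> [_ qzT1] fin [_ qu1] /(variational_update_proportional qzT1 fin)[c quE].
pose a := A_term x xi qzT q.
pose Q t (v : Dmax.-tuple bool) :=
  \prod_i varpi (a t) (path_inner v i) (tnth v i).
have Q1 t : \sum_v Q t v = 1 by apply: sum_prod_path => s; exact: sum_varpi.
(* [Z t] is the factor left over by telescoping at time [t]; it is the same for every path. *)
pose Z t := \sum_b rho (a t) (exist _ (Defs.root Dmax) Dmax_gt0) b.
have quQ u : qu u = expR c * \prod_t Z t * \prod_t Q t (u t).
  rewrite quE -mulrA -big_split /=; congr (_ * _); apply: eq_bigr => t _.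
  by rewrite /Q prod_varpi mulrC divfK // gt_eqF // sum_rho_gt0.
(* Summing [quQ] over [u] gives 1 on the left, and the product of the [Q t] also has total mass
   1. *)
have const1 : expR c * \prod_t Z t = 1.
  rewrite -[RHS]qu1; under [RHS]eq_bigr do rewrite quQ.
  by rewrite -big_distrr /= sum_prod_pmf // mulr1.
have quE1 u : qu u = \prod_t Q t (u t) by rewrite quQ const1 mul1r.
have margE t v : q_marginal qu t v = Q t v.
  rewrite /q_marginal; under eq_bigr do rewrite quE1.
  exact: marginal_prod_pmf.
split=> [u|t v].
  by rewrite quE1; apply: eq_bigr => t _; rewrite margE.
by rewrite margE prod_ancestor_child.
Qed.
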